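(* Let $y\in\{1,\dots,C\}$ and let $\hat p_i(s)=(s_i-s_y+1)_+/S(s)$ with $S(s)=\sum_{j=1}^C(s_j-s_y+1)_+$, $s\in\mathbb R^C$, be the Rankmax mapping, with Jacobian $J_{\mathrm{rm}}(s)=\nabla_s\hat p(s)$. On any region with fixed support $\mathcal P$ (necessarily $y\in\mathcal P$), with $m=|\mathcal P|$ and $S=S(s)$, $$J_{\mathrm{rm}}(s)\big|_{\mathcal P\times\mathcal P}=\frac1S\Bigl[(I-\hat p\,\mathbf 1^\top)-(\mathbf 1-m\hat p)\,e_y^\top\Bigr],\qquad J_{\mathrm{rm}}(s)\big|_{\mathcal P^c\times\{1,\dots,C\}}=0,$$ where $\hat p$, $\mathbf 1$, $e_y$ denote the corresponding vectors restricted to coordinates in $\mathcal P$. Hence $\|J_{\mathrm{rm}}(s)\|_2\lesssim m/S$, i.e. there is an absolute constant $K$ (independent of $C$, $y$, $s$, $\mathcal P$) with $\|J_{\mathrm{rm}}(s)\|_2\le K\,m/S(s)$ at every such $s$.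
   Context: $(t)_+=\max\{t,0\}$. The support at $s$ is $\{i:\hat p_i(s)>0\}$; ''on a region with fixed support $\mathcal P$'' means at points $s$ such that the support equals $\mathcal P$ on a neighborhood of $s$. $\mathbf 1$ is the all-ones vector, $e_y$ the standard basis vector of class $y$, $\mathcal P^c$ the complement of $\mathcal P$ in $\{1,\dots,C\}$, and $\|\cdot\|_2$ the spectral norm. *)

(* Defs.v *)
From mathcomp Require Import all_boot all_order all_algebra.
From mathcomp Require Import all_classical all_reals all_analysis.
Set Implicit Arguments.
Unset Strict Implicit.
Unset Printing Implicit Defensive.
Import Order.TTheory GRing.Theory Num.Theory numFieldNormedType.Exports.
Local Open Scope classical_set_scope.
Local Open Scope ring_scope.

Definition pos_part (R : realType) (t : R) : R := Num.max t 0.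

Definition rankmax_sum (R : realType) (C : nat) (y : 'I_C) (s : 'rV[R]_C) : R :=
  \sum_(j < C) pos_part (s 0 j - s 0 y + 1).

Definition rankmax (R : realType) (C : nat) (y : 'I_C) (s : 'rV[R]_C) :
    'rV[R]_C :=
  \row_(i < C) (pos_part (s 0 i - s 0 y + 1) / rankmax_sum y s).

Definition rankmax_support (R : realType) (C : nat) (y : 'I_C) (s : 'rV[R]_C) :
    {set 'I_C} :=
  [set i : 'I_C | 0 < rankmax y s 0 i]%SET.

Definition fixed_support (R : realType) (C : nat) (y : 'I_C) (P : {set 'I_C})
    (s : 'rV[R]_C) : Prop :=
  \forall t \near s, rankmax_support y t = P.

(* [jacobian] acts on row vectors from the right, so its (j, i) entry is the
   partial derivative of the i-th component along the j-th coordinate; the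
   transpose restores the usual convention (rows indexed by components). *)
Definition rankmax_jacobian (R : realType) (C : nat) (y : 'I_C)
    (s : 'rV[R]_C) : 'M[R]_C :=
  (jacobian (rankmax y) s)^T.

Definition restrict_rows (R : realType) (C n : nat) (P : {set 'I_C})
    (A : 'M[R]_(C, n)) : 'M[R]_(#|P|, n) :=
  rowsub (fun i : 'I_#|P| => enum_val i) A.

Definition restrict_block (R : realType) (C : nat) (P : {set 'I_C})
    (A : 'M[R]_C) : 'M[R]_#|P| :=
  mxsub (fun i : 'I_#|P| => enum_val i) (fun j : 'I_#|P| => enum_val j) A.

(* The library norm on matrices is the entrywise sup norm, hence the explicit
   Euclidean norm and the operator norm it induces. *)
Definition l2norm (R : realType) (n : nat) (x : 'cV[R]_n) : R :=
  Num.sqrt (\sum_(i < n) x i 0 ^+ 2).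

Definition spectral_norm (R : realType) (m n : nat) (A : 'M[R]_(m, n)) : R :=
  sup [set l2norm (A *m x) | x in [set x : 'cV[R]_n | l2norm x <= 1]].

(* The supremum is over a nonempty bounded set, so [sup] takes no default
   value. *)
Lemma spectral_norm_has_sup (R : realType) (m n : nat) (A : 'M[R]_(m, n)) :
  has_sup [set l2norm (A *m x) | x in [set x : 'cV[R]_n | l2norm x <= 1]].
Proof.
split.
  exists (l2norm (A *m 0)); exists 0 => //=.
  by rewrite /l2norm big1 ?sqrtr0 // => i _; rewrite mxE expr0n.
exists (Num.sqrt (\sum_(i < m) (\sum_(j < n) `|A i j|) ^+ 2)) => _ [x /= x1 <-].
have x1j j : `|x j 0| <= 1.
  apply: le_trans x1; rewrite -sqrtr_sqr; apply: ler_wsqrtr.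
  by rewrite (bigD1 j) //= lerDl sumr_ge0 // => i _; exact: sqr_ge0.
apply: ler_wsqrtr; apply: ler_sum => i _; rewrite -[leLHS]real_normK ?num_real//.
rewrite lerXn2r ?nnegrE ?normr_ge0 ?sumr_ge0// mxE.
apply: le_trans (ler_norm_sum _ _ _) _; apply: ler_sum => j _.
by rewrite normrM ler_piMr.
Qed.

(* Main.v *)
(* While the support stays equal to [P], the numerators and the denominator of
   Rankmax are affine in the scores, so Rankmax is a quotient of affine maps and
   its first-order remainder is quadratic; this gives the Jacobian [J] by the
   quotient rule. For the norm,
   [S (J x)_i = 1_P(i) (x_i - x_y) - p_i A] with [A = sum_(j in P) (x_j - x_y)],
   and if [x] has norm at most 1 then [|A| <= 2 m]. Since [0 <= p_i <= 1] and the
   [p_i] sum to 1, also [sum_i p_i ^ 2 <= 1], and the squared entries add up to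
   at most [3 (1 + m + 4 m ^ 2) <= (5 m) ^ 2]. *)
Require Import Defs.
From HB Require Import structures.
From mathcomp Require Import all_boot all_order all_algebra.
From mathcomp Require Import all_classical all_reals all_analysis.
From mathcomp Require Import ring lra.
Set Implicit Arguments.
Unset Strict Implicit.
Unset Printing Implicit Defensive.
Import Order.TTheory GRing.Theory Num.Theory numFieldNormedType.Exports.
Local Open Scope ring_scope.

(** * Sup-norm estimates and a differentiability criterion *)

Lemma ler_mx_coord_norm (R : realType) (m n : nat) (A : 'M[R]_(m, n)) i j :
  `|A i j| <= `|A|.
Proof.
rewrite [leRHS]/Num.Def.normr/= mx_normrE.
exact: (le_bigmax _ (fun ij : 'I_m * 'I_n => `|A ij.1 ij.2|) (i, j)).
Qed.

Lemma mx_norm_le (R : realType) (m n : nat) (A : 'M[R]_(m, n)) (k : R) :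
  0 <= k -> (forall i j, `|A i j| <= k) -> `|A| <= k.
Proof.
by move=> k0 Ak; rewrite [leLHS]/Num.Def.normr/= mx_normrE bigmax_le.
Qed.

(** The first bound makes [df] continuous and the second makes the remainder little-o of [h];
    uniqueness of the differential then identifies [df]. *)
Lemma differential_of_quadratic_remainder (R : realType)
    (V W : normedModType R) (f : V -> W) (df : {linear V -> W}) (x : V)
    (a k : R) :
  (forall h, `|df h| <= a * `|h|) ->
  (\forall h \near 0, `|f (h + x) - f x - df h| <= k * `|h| ^+ 2) ->
  differentiable f x /\ 'd f x = df :> (V -> W).
Proof.
move=> dfa fk.
have dfc : continuous df.
  apply/linear_bounded_continuous/linear_boundedP.
  apply: filterS (nbhs_pinfty_ge (num_real a)) => r ar h.
  by apply: le_trans (dfa h) _; rewrite ler_wpM2r.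
have dfo : f \o shift x = cst (f x) + df +o_ 0 id.
  apply/eqaddoP => e e0; near=> h.
  rewrite !fctE /= opprD addrA; apply: (@le_trans _ _ (k * `|h| ^+ 2)).
    by near: h.
  (* The sign of [k] is unknown; [|k| + 1] dominates it and can be divided by, giving the radius
     [e / (|k| + 1)]. *)
  have k0 : 0 < `|k| + 1 by rewrite ltr_wpDl.
  rewrite expr2 mulrA ler_wpM2r//.
  apply: (@le_trans _ _ ((`|k| + 1) * `|h|)).
    by rewrite ler_wpM2r// (le_trans (ler_norm k))// lerDl.
  rewrite mulrC -ler_pdivlMr//.
  by near: h; apply: nbhs0_le; rewrite divr_gt0.
have dE := diff_unique dfc dfo.
by split=> //; apply/diff_locallyP; rewrite dE.
Unshelve. all: by end_near. Qed.

(** * Elementary properties of Rankmax *)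

Section rankmax_values.
Context {R : realType} {C : nat} (y : 'I_C).
Implicit Types s t : 'rV[R]_C.

Lemma pos_part_ge0 (x : R) : 0 <= pos_part x.
Proof. by rewrite /pos_part le_max lexx orbT. Qed.

(** The index [y] alone contributes 1. Hence Rankmax never divides by zero, and dividing by the sum
    does not enlarge an estimate. *)
Lemma rankmax_sum_ge1 s : 1 <= rankmax_sum y s.
Proof.
rewrite /rankmax_sum (bigD1 y)//= subrr add0r {1}/pos_part.
by rewrite (max_idPl ler01) lerDl sumr_ge0// => i _; exact: pos_part_ge0.
Qed.

Lemma rankmax_sum_gt0 s : 0 < rankmax_sum y s.
Proof. exact: lt_le_trans (rankmax_sum_ge1 s). Qed.

Lemma rankmax_ge0 s i : 0 <= rankmax y s 0 i.
Proof.
by rewrite mxE divr_ge0 ?pos_part_ge0// ltW// rankmax_sum_gt0.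
Qed.

Lemma sum_rankmax s : \sum_i rankmax y s 0 i = 1.
Proof.
under eq_bigr do rewrite mxE.
by rewrite -mulr_suml divff// gt_eqF// rankmax_sum_gt0.
Qed.

Lemma rankmax_le1 s i : rankmax y s 0 i <= 1.
Proof.
rewrite -(sum_rankmax s) (bigD1 i)//= lerDl sumr_ge0// => j _.
exact: rankmax_ge0.
Qed.

(** The denominator is positive, so the support is where the margin is positive. With the support
    frozen, the right-hand side is affine in [s]. *)
Lemma pos_part_support s i : pos_part (s 0 i - s 0 y + 1) =
  (i \in rankmax_support y s)%:R * (s 0 i - s 0 y + 1).
Proof.
rewrite inE mxE pmulr_lgt0 ?invr_gt0 ?rankmax_sum_gt0// lt_max ltxx orbF.
by rewrite /pos_part; case: ltP; rewrite ?mul1r ?mul0r.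
Qed.

Lemma mem_rankmax_support s : y \in rankmax_support y s.
Proof.
by rewrite inE mxE divr_gt0 ?rankmax_sum_gt0// subrr add0r lt_max ltr01.
Qed.

End rankmax_values.

(** * The differential on a region of fixed support *)

Section rankmax_differential.
Context {R : realType} {C : nat} (y : 'I_C) (P : {set 'I_C}).
Implicit Types s t h : 'rV[R]_C.

(** The increment of the [i]-th numerator along [h] while the support is [P]. *)
Definition active_margin h i : R := (i \in P)%:R * (h 0 i - h 0 y).

(** The quotient rule in the form [(dN - p dS) / S], with [p = N / S]. *)
Definition rankmax_diff s h : 'rV[R]_C :=
  \row_i ((active_margin h i - rankmax y s 0 i * \sum_j active_margin h j) /
          rankmax_sum y s).

Fact rankmax_diff_is_linear s : linear (rankmax_diff s).
Proof.
move=> a u v; apply/rowP => i; rewrite !mxE.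
have AD j : active_margin (a *: u + v) j =
    a * active_margin u j + active_margin v j.
  by rewrite /active_margin !mxE; ring.
by under eq_bigr do rewrite AD; rewrite AD big_split/= -mulr_sumr; ring.
Qed.

HB.instance Definition _ s :=
  GRing.isLinear.Build R _ _ _ (rankmax_diff s) (rankmax_diff_is_linear s).

Lemma active_margin_le h i : `|active_margin h i| <= 2 * `|h|.
Proof.
rewrite /active_margin normrM; apply: (@le_trans _ _ `|h 0 i - h 0 y|).
  by rewrite ler_piMl// normr_nat lern1 leq_b1.
apply: le_trans (ler_normB _ _) _.
by rewrite mulr_natl mulr2n lerD ?ler_mx_coord_norm.
Qed.

Lemma sum_active_margin_le h : `|\sum_j active_margin h j| <= C%:R * (2 * `|h|).
Proof.
apply: le_trans (ler_norm_sum _ _ _) _.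
apply: (@le_trans _ _ (\sum_(j < C) 2 * `|h|)).
  by apply: ler_sum => j _; exact: active_margin_le.
by rewrite sumr_const card_ord -[leLHS]mulr_natl.
Qed.

Lemma rankmax_numerator_diff_le s h i :
  `|active_margin h i - rankmax y s 0 i * \sum_j active_margin h j| <=
  (C%:R + 1) * (2 * `|h|).
Proof.
apply: le_trans (ler_normB _ _) _.
rewrite mulrDl mul1r addrC lerD ?active_margin_le//.
rewrite normrM (le_trans _ (sum_active_margin_le h))// ler_piMl//.
by rewrite ger0_norm ?rankmax_ge0 ?rankmax_le1.
Qed.

Lemma rankmax_diff_le s h : `|rankmax_diff s h| <= (C%:R + 1) * 2 * `|h|.
Proof.
rewrite -mulrA; apply: mx_norm_le => [|i j].
  by rewrite !mulr_ge0// addr_ge0.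
rewrite mxE; apply: le_trans (rankmax_numerator_diff_le s h j).
rewrite normrM normfV ler_piMr// (gtr0_norm (rankmax_sum_gt0 _ _)).
by rewrite invf_le1 ?rankmax_sum_gt0// rankmax_sum_ge1.
Qed.

(* With [q] the value at [h + s] and [p] the value at [s], both the numerators
   and the denominator of Rankmax are affine as long as the support is [P], so
   [S (q - p - L h) = A (p - q)] where [A] is the increment of [S]. *)
Lemma rankmax_remainder_le s h :
  rankmax_support y s = P -> rankmax_support y (h + s) = P ->
  `|rankmax y (h + s) - rankmax y s - rankmax_diff s h| <=
  C%:R * 2 * ((C%:R + 1) * 2) * `|h| ^+ 2.
Proof.
move=> sP tP.
set A := \sum_j active_margin h j.
have S0 := rankmax_sum_gt0 y s; have T0 := rankmax_sum_gt0 y (h + s).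
have numD i : pos_part ((h + s) 0 i - (h + s) 0 y + 1) =
    pos_part (s 0 i - s 0 y + 1) + active_margin h i.
  by rewrite !pos_part_support sP tP /active_margin !mxE; ring.
have TE : rankmax_sum y (h + s) = rankmax_sum y s + A.
  by rewrite /rankmax_sum; under eq_bigr do rewrite numD; rewrite big_split.
have scaled t i : rankmax_sum y t * rankmax y t 0 i =
    pos_part (t 0 i - t 0 y + 1).
  by rewrite mxE mulrC divfK// gt_eqF// rankmax_sum_gt0.
apply: mx_norm_le => [|i j]; first by rewrite !mulr_ge0// addr_ge0.
rewrite (ord1 i) {i}.
(* The exact increment has the shape of the differential, with the new denominator in place of the
   old one; it is thus of first order in [h]. *)
have incr : rankmax y (h + s) 0 j - rankmax y s 0 j =
    (active_margin h j - rankmax y s 0 j * A) / rankmax_sum y (h + s).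
  apply: (mulfI (lt0r_neq0 T0)); rewrite mulrBr scaled numD -scaled TE.
  by rewrite [RHS]mulrC divfK -TE ?lt0r_neq0// TE; ring.
have rem : (rankmax y (h + s) - rankmax y s - rankmax_diff s h) 0 j =
    A * (rankmax y s 0 j - rankmax y (h + s) 0 j) / rankmax_sum y s.
  apply: (mulfI (lt0r_neq0 S0)); rewrite [RHS]mulrC divfK ?lt0r_neq0//.
  transitivity (rankmax_sum y s * (rankmax y (h + s) 0 j - rankmax y s 0 j) -
      (active_margin h j - rankmax y s 0 j * A)).
    rewrite (_ : forall u v w : 'rV[R]_C, (u - v - w) 0 j =
      u 0 j - v 0 j - w 0 j); last by move=> u v w; rewrite !mxE.
    rewrite [rankmax_diff s h 0 j]mxE -/A mulrBr; congr (_ - _).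
    by rewrite [LHS]mulrC divfK// lt0r_neq0.
  have -> : active_margin h j = rankmax_sum y (h + s) * rankmax y (h + s) 0 j -
      rankmax_sum y s * rankmax y s 0 j by rewrite !scaled numD addrC addKr.
  by rewrite TE; ring.
have invS t : `|(rankmax_sum y t)^-1| <= 1.
  rewrite normfV (gtr0_norm (rankmax_sum_gt0 _ _)) invf_le1 ?rankmax_sum_gt0//.
  exact: rankmax_sum_ge1.
rewrite rem normrM -[leRHS]mulr1 ler_pM// normrM.
(* The first factor bounds [A], the second the numerator of the increment; both inverse denominators
   are at most 1. *)
rewrite (_ : _ * `|h| ^+ 2 = C%:R * (2 * `|h|) * ((C%:R + 1) * (2 * `|h|)));
  last by ring.
rewrite ler_pM ?sum_active_margin_le// distrC incr normrM -[leRHS]mulr1.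
by rewrite ler_pM// rankmax_numerator_diff_le.
Qed.

Lemma rankmax_differential s : fixed_support y P s ->
  differentiable (rankmax y) s /\
  'd (rankmax y) s = rankmax_diff s :> ('rV[R]_C -> 'rV[R]_C).
Proof.
move=> sP; apply: differential_of_quadratic_remainder (rankmax_diff_le s) _.
have s0 : rankmax_support y s = P := nbhs_singleton sP.
move: sP; rewrite /fixed_support (near_shift 0) subr0.
by apply: filterS => h hP; exact: rankmax_remainder_le.
Qed.

Lemma sum_active_margin h :
  \sum_i active_margin h i = \sum_(i in P) h 0 i - #|P|%:R * h 0 y.
Proof.
transitivity (\sum_(i in P) (h 0 i - h 0 y)).
  rewrite [RHS]big_mkcond; apply: eq_bigr => i _.
  by rewrite /active_margin; case: (i \in P); rewrite ?mul1r ?mul0r.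
by rewrite sumrB sumr_const mulr_natl.
Qed.

Lemma sum_active_margin_delta j : y \in P ->
  \sum_k active_margin (delta_mx 0 j) k =
  (j \in P)%:R - #|P|%:R * (y == j)%:R.
Proof.
move=> yP; rewrite sum_active_margin !mxE eqxx /=; congr (_ - _).
under eq_bigr do rewrite mxE eqxx /=.
have [jP|jNP] := boolP (j \in P).
  by rewrite (bigD1 j)//= eqxx big1 ?addr0// => k /andP[_ /negbTE ->].
by rewrite big1// => k kP; case: eqP => // kj; rewrite -kj kP in jNP.
Qed.

Lemma rankmax_jacobianE s i j : fixed_support y P s ->
  rankmax_jacobian y s i j =
  (active_margin (delta_mx 0 j) i -
   rankmax y s 0 i * \sum_k active_margin (delta_mx 0 j) k) /
  rankmax_sum y s.
Proof.
by move=> /rankmax_differential[_ dE]; rewrite mxE [LHS]mxE dE mxE.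
Qed.

(** Lets the norm estimate work with the closed formula of the differential instead of matrix
    entries. *)
Lemma mul_rankmax_jacobian s (x : 'cV[R]_C) : fixed_support y P s ->
  rankmax_jacobian y s *m x = (rankmax_diff s x^T)^T.
Proof.
move=> /rankmax_differential[_ dE].
by rewrite -[x in LHS]trmxK -trmx_mul mul_rV_lin1 dE.
Qed.

End rankmax_differential.

(** * The spectral norm bound *)

Lemma rankmax_eq0 (R : realType) (C : nat) (y : 'I_C) (s : 'rV[R]_C) i :
  i \notin rankmax_support y s -> rankmax y s 0 i = 0.
Proof.
by move=> iP; rewrite mxE pos_part_support (negbTE iP) !mul0r.
Qed.

Lemma l2norm_entry_le (R : realType) (n : nat) (x : 'cV[R]_n) i :
  `|x i 0| <= l2norm x.
Proof.
rewrite -sqrtr_sqr; apply: ler_wsqrtr.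
by rewrite (bigD1 i)//= lerDl sumr_ge0// => j _; exact: sqr_ge0.
Qed.

Lemma l2norm_le (R : realType) (n : nat) (x : 'cV[R]_n) (k : R) :
  0 <= k -> \sum_i x i 0 ^+ 2 <= k ^+ 2 -> l2norm x <= k.
Proof.
by move=> k0 xk; rewrite -(ger0_norm k0) -sqrtr_sqr; exact: ler_wsqrtr.
Qed.

Lemma spectral_norm_rankmax_jacobian_le (R : realType) (C : nat) (y : 'I_C)
    (P : {set 'I_C}) (s : 'rV[R]_C) : fixed_support y P s ->
  spectral_norm (rankmax_jacobian y s) <= 5 * #|P|%:R / rankmax_sum y s.
Proof.
move=> sP; apply: ge_sup; first exact: (spectral_norm_has_sup _).1.
move=> _ [x /= x1 <-].
have S0 := rankmax_sum_gt0 y s.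
have s0 : rankmax_support y s = P := nbhs_singleton sP.
have yP : y \in P by rewrite -s0 mem_rankmax_support.
set m : R := #|P|%:R.
have m1 : 1 <= m by rewrite ler1n card_gt0; apply/set0Pn; exists y.
have xle i : `|x i 0| <= 1 := le_trans (l2norm_entry_le _ _) x1.
have xsq : \sum_i x i 0 ^+ 2 <= 1.
  rewrite -[leLHS]sqr_sqrtr; last by apply: sumr_ge0 => i _; exact: sqr_ge0.
  by rewrite expr_le1// sqrtr_ge0.
rewrite (mul_rankmax_jacobian _ sP); apply: l2norm_le.
  by rewrite divr_ge0 ?(ltW S0)// mulr_ge0.
set A := \sum_j active_margin y P x^T j.
have Ale : `|A| <= 2 * m.
  rewrite /A sum_active_margin (le_trans (ler_normB _ _))// mulr2n mulrDl mul1r.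
  apply: lerD.
    apply: le_trans (ler_norm_sum _ _ _) _.
    rewrite /m -sumr_const; apply: ler_sum => i _; rewrite mxE.
    exact: xle.
  by rewrite normrM normr_nat mxE ler_piMr.
have A2 : A ^+ 2 <= 4 * m ^+ 2.
  rewrite -real_normK ?num_real// (_ : 4 * _ = (2 * m) ^+ 2); last by ring.
  by rewrite lerXn2r// nnegrE// mulr_ge0// (le_trans _ m1).
have y2 : x y 0 ^+ 2 <= 1.
  by rewrite -real_normK ?num_real// expr_le1.
(* The three terms dominate the squares of [x_i], [x_y] and [p_i A]; the last uses [p_i ^ 2 <= p_i],
   so that summing over [i] yields [4 m ^ 2]. *)
pose bound i : R := 3 * (x i 0 ^+ 2 + (i \in P)%:R +
  4 * m ^+ 2 * rankmax y s 0 i).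
apply: (@le_trans _ _ ((\sum_i bound i) / rankmax_sum y s ^+ 2)).
  rewrite mulr_suml; apply: ler_sum => i _.
  rewrite mxE mxE -/A exprMn exprVn ler_wpM2r ?invr_ge0 ?sqr_ge0//.
  have p0 := rankmax_ge0 y s i; have p1 := rankmax_le1 y s i.
  have : (rankmax y s 0 i * A) ^+ 2 <= 4 * m ^+ 2 * rankmax y s 0 i.
    by rewrite exprMn mulrC ler_pM ?sqr_ge0// expr2 ler_piMr.
  (* The difference of the two sides is exactly the sum of the three squares supplied. *)
  have sq3 (a b c : R) : (a - b - c) ^+ 2 <= 3 * (a ^+ 2 + b ^+ 2 + c ^+ 2).
    have := sqr_ge0 (a + b); have := sqr_ge0 (a + c); have := sqr_ge0 (b - c).
    nra.
  rewrite /bound /active_margin ![x^T _ _]mxE; case: (i \in P) => pA.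
    rewrite mul1r; apply: le_trans (sq3 _ _ _) _.
    by rewrite ler_wpM2l// !lerD.
  have := sqr_ge0 (rankmax y s 0 i * A); have := sqr_ge0 (x i 0).
  rewrite mul0r sub0r sqrrN addr0; lra.
rewrite [leRHS]expr_div_n ler_wpM2r ?invr_ge0 ?sqr_ge0//.
rewrite /bound -mulr_sumr !big_split/= -mulr_sumr sum_rankmax.
rewrite (_ : \sum_i _%:R = m); last first.
  rewrite /m -sum1_card natr_sum [RHS]big_mkcond.
  by apply: eq_bigr => i _; case: (i \in P).
(* Since [m >= 1], both 1 and [m] are at most [m ^ 2], so the left side is at most [18 m ^ 2]. *)
nra.
Qed.

(** * Jacobian blocks and the absolute constant *)

Theorem lemmaB9 (R : realType) :
  (forall (C : nat) (y : 'I_C) (P : {set 'I_C}) (s : 'rV[R]_C),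
     fixed_support y P s ->
     let m : R := #|P|%:R in
     let S := rankmax_sum y s in
     let phat : 'cV[R]_#|P| := restrict_rows P (rankmax y s)^T in
     let ones : 'cV[R]_#|P| := const_mx 1 in
     let e_y : 'cV[R]_#|P| := restrict_rows P (delta_mx y 0) in
     [/\ y \in P,
         differentiable (rankmax y) s,
         restrict_block P (rankmax_jacobian y s) =
           S^-1 *: ((1%:M - phat *m ones^T) - (ones - m *: phat) *m e_y^T)
       & restrict_rows (~: P)%SET (rankmax_jacobian y s) = 0]) /\
  (exists K : R,
     forall (C : nat) (y : 'I_C) (P : {set 'I_C}) (s : 'rV[R]_C),
       fixed_support y P s ->
       spectral_norm (rankmax_jacobian y s) <=
         K * #|P|%:R / rankmax_sum y s).
Proof.
split=> [C y P s sP m S phat ones e_y|].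
  have s0 : rankmax_support y s = P := nbhs_singleton sP.
  have [ds _] := rankmax_differential sP.
  have yP : y \in P by rewrite -s0 mem_rankmax_support.
  split=> //; apply/matrixP => i j.
    have iP := enum_valP i; have jP := enum_valP j.
    rewrite [LHS]mxE (rankmax_jacobianE _ _ sP) -/S [RHS]mxE mulrC; congr (_ * _).
    rewrite sum_active_margin_delta// jP.
    have -> : ((1%:M - phat *m ones^T) - (ones - m *: phat) *m e_y^T) i j =
      (i == j)%:R - phat i 0 - (1 - m * phat i 0) * e_y j 0.
      by rewrite !mxE !big_ord1 !mxE mulr1.
    have -> : phat i 0 = rankmax y s 0 (enum_val i) by rewrite mxE [LHS]mxE.
    have -> : e_y j 0 = (y == enum_val j)%:R.
      by rewrite /e_y/restrict_rows !mxE andbT eq_sym.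
    (* With [d = [i = j]] and [e = [y = j]], this regroups [d - e - p (1 - m e)] as
       [d - p - (1 - m p) e]. *)
    rewrite /active_margin iP !mxE /= (inj_eq enum_val_inj) -/m; ring.
  have := enum_valP i; rewrite inE => iP.
  rewrite [LHS]mxE (rankmax_jacobianE _ _ sP) [RHS]mxE /active_margin.
  (* Outside [P] both the indicator and the Rankmax value vanish, which kills the whole row. *)
  rewrite (rankmax_eq0 (y := y)) ?s0//.
  by rewrite (negbTE iP) !mul0r subrr mul0r.
exists 5 => C y P s sP.
exact: spectral_norm_rankmax_jacobian_le.
Qed.
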